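(* Let $\omega\in\Lambda^{n-1}(\mathbb{R}^n)$ be a divergence-free system. Then $[\omega]\in H^{n-1}_{1,1,\dots,1}(\mathbb{R}^n)$.
   Context: All objects are smooth. $\Lambda^k(\mathbb{R}^n)$ is the space of differential $k$-forms on $\mathbb{R}^n$, and $d$ is the exterior derivative. It is assumed that $\dim H^{n-1}(\mathbb{R}^n)=0$, where $H^k(\mathbb{R}^n)$ is the $k$-th de Rham cohomology group. A divergence-free system is a phase flow $\dot{\mathbf x}=\mathbf l(\mathbf x)$ on $\mathbb{R}^n$ with $\operatorname{div}\mathbf l=0$. It is identified with the $(n-1)$-form representing it, $\omega=(\dot{\mathbf x}\cdot d\mathbf S)=\sum_{k=1}^n l_k\,dS_k$, where $dS_k=(-1)^k dx_1\wedge\dots\wedge[dx_k]\wedge\dots\wedge dx_n$ and $[dx_k]$ means that the factor $dx_k$ is omitted. The divergence-free condition says that $\omega$ is closed. $Z^k=\ker(d:\Lambda^k(\mathbb{R}^n)\to\Lambda^{k+1}(\mathbb{R}^n))$ is the space of closed $k$-forms. $B^{1,1,\dots,1}$ (with $k$ ones) is built from $k$ copies of $\operatorname{im}(d:\Lambda^0(\mathbb{R}^n)\to\Lambda^1(\mathbb{R}^n))$ and corresponds to the $k$-forms that are exterior products of exact $1$-forms, $\bigwedge_{i=1}^k d\mu^0_i$ with $\mu^0_i\in\Lambda^0(\mathbb{R}^n)$. The quotient is denoted $H^k_{1,1,\dots,1}(\mathbb{R}^n)=Z^k/B^{1,1,\dots,1}$ (with $k$ lower indices equal to $1$), and $[\omega]$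 denotes the class of $\omega$; in the theorem $k=n-1$. *)

(* Defs.v *)
From mathcomp Require Import all_boot all_order all_algebra.
From mathcomp Require Import all_classical all_reals all_analysis.

Set Implicit Arguments.
Unset Strict Implicit.
Unset Printing Implicit Defensive.

Import Order.TTheory GRing.Theory Num.Theory numFieldNormedType.Exports.
Local Open Scope classical_set_scope.
Local Open Scope ring_scope.

Definition partial (R : realType) (n : nat) (i : 'I_n) (f : 'rV[R]_n -> R) :
  'rV[R]_n -> R := fun x => 'D_(delta_mx 0 i) f x.

Fixpoint Ck (R : realType) (n k : nat) (f : 'rV[R]_n -> R) : Prop :=
  if k is k'.+1 then
    (forall x, differentiable f x) /\ (forall i : 'I_n, Ck k' (partial i f))
  else continuous f.

Definition smooth (R : realType) (n : nat) (f : 'rV[R]_n -> R) : Prop :=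
  forall k, Ck k f.

(** Differential forms on R^n.  At each point a k-form takes k tangent vectors,
    given as the rows of a k x n matrix.  [dform] is the ambient vector space of
    all such functions; [Lambda] singles out the smooth fields of alternating
    multilinear forms. *)

Definition dform (R : realType) (n k : nat) : Type :=
  'rV[R]_n -> 'M[R]_(k, n) -> R.

Definition row_multilinear (R : realType) (k n : nat) (f : 'M[R]_(k, n) -> R) :
    Prop :=
  forall (A B C : 'M[R]_(k, n)) (i : 'I_k) (b c : R),
    row i A = b *: row i B + c *: row i C ->
    row' i B = row' i A -> row' i C = row' i A ->
    f A = b * f B + c * f C.

Definition row_alternating (R : realType) (k n : nat) (f : 'M[R]_(k, n) -> R) :
    Prop :=
  forall (A : 'M[R]_(k, n)) (i j : 'I_k), i != j -> row i A = row j A -> f A = 0.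

Definition Lambda (R : realType) (n k : nat) : set (dform R n k) :=
  [set w | [/\ forall x, row_multilinear (w x),
               forall x, row_alternating (w x) &
               forall A, smooth (fun x => w x A)]].
Arguments Lambda : clear implicits.

(** The invariant formula for the exterior derivative, on constant vector
    fields (whose Lie brackets vanish):
    dw(v_0, .., v_k) = sum_i (-1)^i D_{v_i} (w(v_0, .., [v_i], .., v_k)). *)
Definition ext_d (R : realType) (n k : nat) (w : dform R n k) : dform R n k.+1 :=
  fun x A =>
    \sum_(i < k.+1)
      (-1) ^+ i * 'D_(row i A) (fun y => w y (row' i A : 'M[R]_(k, n))) x.

(** (a_0 /\ .. /\ a_{k-1}) (v_0, .., v_{k-1}) = det (a_i (v_j)); this
    normalisation of the exterior product is the one compatible with [ext_d]. *)
Definition wedge1 (R : realType) (n k : nat) (a : 'I_k -> dform R n 1) :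
    dform R n k :=
  fun x A => \det (\matrix_(i < k, j < k) a i x (row j A)).

Definition dx (R : realType) (n : nat) (i : 'I_n) : dform R n 1 :=
  fun _ v => v 0 i.

(** dS_k = (-1)^k dx_1 /\ .. [dx_k] .. /\ dx_n with k = i + 1, since indices
    start at 0 here. *)
Definition dS (R : realType) (n : nat) (i : 'I_n) : dform R n n.-1 :=
  (-1) ^+ i.+1 *: wedge1 (fun j : 'I_n.-1 => dx (lift i j)).

Definition smooth_field (R : realType) (n : nat) (l : 'rV[R]_n -> 'rV[R]_n) :
    Prop :=
  forall i, smooth (fun x => l x 0 i).

Definition divergence (R : realType) (n : nat) (l : 'rV[R]_n -> 'rV[R]_n) :
    'rV[R]_n -> R :=
  fun x => \sum_(i < n) partial i (fun y => l y 0 i) x.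

Definition flux_form (R : realType) (n : nat) (l : 'rV[R]_n -> 'rV[R]_n) :
    dform R n n.-1 :=
  fun x A => \sum_(i < n) l x 0 i * dS i x A.

Definition divergence_free_system (R : realType) (n : nat) (w : dform R n n.-1) :
    Prop :=
  exists l : 'rV[R]_n -> 'rV[R]_n,
    [/\ smooth_field l, forall x, divergence l x = 0 & w = flux_form l].

Definition lin_span (R : realType) (V : lmodType R) (S : set V) : set V :=
  [set v | exists m (c : 'I_m -> R) (s : 'I_m -> V),
     (forall i, S (s i)) /\ v = \sum_(i < m) c i *: s i].

(** Quotients Z / B by a linear subspace B, as sets of cosets. *)

Definition coset_class (R : realType) (V : lmodType R) (B : set V) (v : V) :
    set V :=
  [set u | B (u - v)].

Definition quotient_space (R : realType) (V : lmodType R) (Z B : set V) :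
    set (set V) :=
  coset_class B @` Z.

(** dim (Z / B) = m: some m elements of Z induce a basis of Z / B. *)
Definition quotient_dim (R : realType) (V : lmodType R) (Z B : set V)
    (m : nat) : Prop :=
  exists e : 'I_m -> V, (forall i, Z (e i)) /\
    forall z, Z z -> exists! c : 'rV[R]_m,
      B (z - \sum_(i < m) c 0 i *: e i).

Definition closed_forms (R : realType) (n k : nat) : set (dform R n k) :=
  [set w | Lambda R n k w /\ ext_d w = 0].
Arguments closed_forms : clear implicits.

Definition exact_forms (R : realType) (n k : nat) : set (dform R n k) :=
  match k return set (dform R n k) with
  | 0 => [set 0]
  | k'.+1 => @ext_d R n k' @` Lambda R n k'
  end.
Arguments exact_forms : clear implicits.

Definition deRham_dim (R : realType) (n k m : nat) : Prop :=
  quotient_dim (closed_forms R n k) (exact_forms R n k) m.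

Definition B_ones (R : realType) (n k : nat) : set (dform R n k) :=
  [set w | exists a : 'I_k -> dform R n 1,
     (forall i, exact_forms R n 1 (a i)) /\ w = wedge1 a].
Arguments B_ones : clear implicits.

(** Products of exact 1-forms are not stable under addition in general: the
    quotient of Z^k by B^{1,..,1} is the one by the subspace they span. *)

Definition H_ones (R : realType) (n k : nat) : set (set (dform R n k)) :=
  quotient_space (closed_forms R n k) (lin_span (B_ones R n k)).
Arguments H_ones : clear implicits.

Definition class_ones (R : realType) (n k : nat) (w : dform R n k) :
    set (dform R n k) :=
  coset_class (lin_span (B_ones R n k)) w.

(* Main.v *)
(** Contracting the volume form with [l] gives, up to sign, the flux form
    [A |-> sum_i (-1)^i l_i det (col' i A)].  Its exterior derivative at an
    n x n matrix [A] is minus the sum over [j] and [k] of [d_k l_j] times the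
    [(j, k)] entry of [\adj A *m A = (\det A)%:M], hence [- div l * \det A].
    So a divergence-free flux form is closed, and its class belongs to the
    quotient. *)
Require Import Defs.
From mathcomp Require Import all_boot all_order all_algebra.
From mathcomp Require Import all_classical all_reals all_analysis.
From mathcomp Require Import ring.

Set Implicit Arguments.
Unset Strict Implicit.
Unset Printing Implicit Defensive.

Import Order.TTheory GRing.Theory Num.Theory numFieldNormedType.Exports.
Local Open Scope classical_set_scope.
Local Open Scope ring_scope.

Section Smooth.
Variables (R : realType) (n : nat).
Implicit Types f g : 'rV[R]_n -> R.

Lemma Ck_cst (c : R) k : Ck k (fun _ : 'rV[R]_n => c).
Proof.
(* The constant is generalised because the partial derivatives are the constant 0, not [c]. *)
elim: k c => [|k IHk] c /=; first exact: cst_continuous.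
split=> [x|i]; first exact: differentiable_cst.
suff -> : partial i (fun _ : 'rV[R]_n => c) = (fun=> 0) by exact: IHk.
by apply/funext => x; rewrite /partial derive_cst.
Qed.

(** Scaling and addition are treated together, in the shape that a sum of scaled terms takes when
    its first term is split off. *)
Lemma CkZD (a : R) k f g : Ck k f -> Ck k g -> Ck k (fun x => a * f x + g x).
Proof.
elim: k f g => [|k IHk] f g /=.
  by move=> cf cg x; apply: cvgD (cg x); apply: cvgMr; exact: cf.
move=> [df Cf] [dg Cg].
have daf x : differentiable (a \*: f) x by exact: differentiableZ.
split=> [x|i]; first exact: differentiableD.
suff -> : partial i (fun x => a * f x + g x) =
          (fun x => a * partial i f x + partial i g x) by exact: IHk.
apply/funext => x; rewrite /partial.
have -> : (fun x => a * f x + g x) = (a \*: f) + g by [].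
by rewrite deriveD ?deriveZ //; exact: diff_derivable.
Qed.

Lemma smooth_lincomb (I : Type) (r : seq I) (F : I -> 'rV[R]_n -> R)
    (c : I -> R) :
  (forall i, smooth (F i)) -> smooth (fun x => \sum_(i <- r) c i * F i x).
Proof.
move=> sF k; elim: r => [|i r IHr].
  by under eq_fun do rewrite big_nil; exact: Ck_cst.
by under eq_fun do rewrite big_cons; apply: CkZD IHr; exact: sF.
Qed.

Lemma smooth_differentiable f x : smooth f -> differentiable f x.
Proof. by move=> /(_ 1%N) []. Qed.

(** The differential is linear in the direction, so [v] can be expanded in the standard basis. *)
Lemma derive_partial f (x v : 'rV[R]_n) : differentiable f x ->
  'D_v f x = \sum_(k < n) v 0 k * partial k f x.
Proof.
move=> df; rewrite deriveE // [in LHS](row_sum_delta v) linear_sum /=.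
by apply: eq_bigr => k _; rewrite linearZ /= /partial deriveE.
Qed.

Lemma derive_lincomb p (F : 'I_p -> 'rV[R]_n -> R) (c : 'I_p -> R)
    (x v : 'rV[R]_n) : (forall i, differentiable (F i) x) ->
  'D_v (fun y => \sum_i c i * F i y) x = \sum_i c i * 'D_v (F i) x.
Proof.
move=> dF; have -> : (fun y => \sum_i c i * F i y) = \sum_i (c i \*: F i).
  by apply/funext => y; rewrite fct_sumE.
rewrite derive_sum => [|i]; last exact/diff_derivable/differentiableZ.
by apply: eq_bigr => i _; rewrite deriveZ //; exact: diff_derivable.
Qed.

End Smooth.

Section Flux.
Variables (R : realType) (m : nat) (l : 'rV[R]_m.+1 -> 'rV[R]_m.+1).

(** The matrix in [wedge1] is the transpose of [col' i A]. For fixed [A], this is a linear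
    combination of the components of [l] with constant coefficients. *)
Lemma flux_formE x (A : 'M[R]_(m, m.+1)) :
  flux_form l x A = \sum_(i < m.+1) ((-1) ^+ i.+1 * \det (col' i A)) * l x 0 i.
Proof.
apply: eq_bigr => i _; rewrite mulrC; congr (_ * _).
rewrite /dS /wedge1 /dx -det_tr; congr (_ * \det _).
by apply/matrixP => j k; rewrite !mxE.
Qed.

Lemma flux_form_Lambda : smooth_field l -> Lambda R m.+1 m (flux_form l).
Proof.
move=> sl; split=> [x A B C i b c rA rB rC|x A i j neq_ij rA|A].
(* Deleting a column respects relations between rows, so each minor inherits multilinearity from the
   determinant. *)
- rewrite !flux_formE !mulr_sumr -big_split; apply: eq_bigr => j _ /=.
  rewrite (@determinant_multilinear _ _ _ (col' j B) (col' j C) i b c).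
  + by ring.
  + by apply/rowP => p; move/rowP: rA => /(_ (lift j p)); rewrite !mxE.
  + apply/matrixP => p q.
    by move/matrixP: rB => /(_ p (lift j q)); rewrite !mxE.
  + apply/matrixP => p q.
    by move/matrixP: rC => /(_ p (lift j q)); rewrite !mxE.
- rewrite flux_formE big1 // => k _.
  rewrite (@determinant_alternate _ _ _ i j neq_ij) ?mulr0 ?mul0r // => p.
  by move/rowP: rA => /(_ (lift k p)); rewrite !mxE.
- by under eq_fun do rewrite flux_formE; exact: smooth_lincomb.
Qed.

Lemma ext_d_flux_form x (A : 'M[R]_m.+1) : smooth_field l ->
  ext_d (flux_form l) x A = - divergence l x * \det A.
Proof.
move=> sl; rewrite /ext_d.
transitivity (- \sum_j \sum_k partial k (fun y => l y 0 j) x *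
                 (\adj A *m A) j k).
  rewrite -sumrN.
  (* The minors of [row' i A] do not depend on [y], so only the components of [l] are
     differentiated. *)
  under eq_bigr => i _.
    under eq_fun do rewrite flux_formE.
    rewrite derive_lincomb; last by move=> j; exact: smooth_differentiable.
    over.
  under eq_bigr do rewrite mulr_sumr.
  rewrite exchange_big; apply: eq_bigr => j _ /=.
  (* The sign [(-1)^i] of [ext_d] and [(-1)^(j+1)] of [dS] turn the minor into minus the cofactor
     [\adj A j i]; the factor [A i k] is a coordinate of the direction [row i A]. *)
  transitivity (\sum_i \sum_k - (partial k (fun y => l y 0 j) x *
                                  (\adj A j i * A i k))).
    apply: eq_bigr => i _.
    rewrite derive_partial; last exact: smooth_differentiable.
    rewrite mulrA mulr_sumr; apply: eq_bigr => k _.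
    rewrite [\adj A j i]mxE /cofactor.
    have -> : row' i (col' j A) = col' j (row' i A).
      by apply/matrixP => p q; rewrite !mxE.
    by rewrite [row i A 0 k]mxE exprS exprD; ring.
  rewrite exchange_big -sumrN; apply: eq_bigr => k _ /=.
  by rewrite mxE mulr_sumr sumrN.
rewrite mul_adj_mx mulNr mulr_suml; congr (- _); apply: eq_bigr => j _.
(* Only [k = j] survives in a scalar matrix. *)
rewrite (bigD1 j) //= big1 => [|k /negPf neq_kj].
  by rewrite mxE eqxx addr0.
by rewrite mxE eq_sym neq_kj mulr0.
Qed.

End Flux.

Theorem theorem2 (R : realType) (n : nat) (n_gt0 : (0 < n)%N)
    (deRham0 : deRham_dim R n n.-1 0)
    (w : dform R n n.-1) (w_divfree : divergence_free_system w) :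
  H_ones R n n.-1 (class_ones w).
Proof.
(* Writing [n] as [m.+1] makes [n.-1] reduce to [m], so [ext_d] of the form takes square
   matrices. *)
case: n n_gt0 w w_divfree {deRham0} => // m _ w [l [sl dl0 ->]].
exists (flux_form l) => //; split; first exact: flux_form_Lambda.
apply/funext => x; apply/funext => A.
by rewrite ext_d_flux_form // dl0 oppr0 mul0r.
Qed.
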